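(* Let $n\ge2$ and let $X=(X_1,\dots,X_n)$ be an isotropic random vector in $\mathbb{R}^n$, with finite third moment, whose distribution is spherically symmetric. Then for any $\theta\in S^{n-1}$, with $W_\theta=\langle X,\theta\rangle$, $$d_{TV}\bigl(\mathcal{L}(W_\theta),\gamma_{\mathbb{R}}\bigr)\le4\,\mathbb{E}\bigl|1-\mathbb{E}[X_2^2\mid X_1]\bigr|\le\frac{4}{n-1}\,\mathbb{E}\bigl|\|X\|_2^2-n\bigr|+\frac{8}{n-1}\le\frac{4}{n-1}\sqrt{\operatorname{Var}\left(\|X\|_2^2\right)}+\frac{8}{n-1}.$$
   Context: $\langle\cdot,\cdot\rangle$ and $\|\cdot\|_2$ are the standard inner product and Euclidean norm on $\mathbb{R}^n$, $S^{n-1}$ is the Euclidean unit sphere, $\mathcal{L}(\cdot)$ denotes distribution, and $\gamma_{\mathbb{R}}$ is the standard Gaussian measure on $\mathbb{R}$. $X$ is isotropic if $\mathbb{E}X_i=0$ and $\mathbb{E}X_iX_j=\delta_{ij}$ for all $i,j$; spherically symmetric means the distribution is invariant under orthogonal transformations. Total variation distance is normalized as $d_{TV}(\mu,\nu)=2\sup\{|\mu(A)-\nu(A)|:A\text{ measurable}\}$. The variance may be $+\infty$. *)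

(* Defs.v *)
(* Library: MathComp-Analysis, over an abstract [R : realType]. *)
From HB Require Import structures.
From mathcomp Require Import all_boot all_order all_algebra.
From mathcomp Require Import all_classical all_reals all_analysis.
From mathcomp Require Import measurable_realfun.

Set Implicit Arguments.
Unset Strict Implicit.
Unset Printing Implicit Defensive.

Import Order.TTheory GRing.Theory Num.Theory.
Import numFieldNormedType.Exports.

Local Open Scope classical_set_scope.
Local Open Scope ring_scope.

(* R^n is [n.-tuple R]: the library equips it with the sigma-algebra generated
   by the coordinates, i.e. the Borel sigma-algebra.  Its norm on matrices and
   row vectors is the sup norm, so the Euclidean one is defined here. *)
Section euclidean.
Context {R : realType} {n : nat}.
Implicit Types x y : n.-tuple R.

Definition dotp x y : R := \sum_(i < n) tnth x i * tnth y i.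

Definition norm2 x : R := Num.sqrt (dotp x x).

Definition sphere : set (n.-tuple R) := [set x | norm2 x = 1].

Definition orthogonalmx (Q : 'M[R]_n) : Prop := Q *m Q^T = 1%:M.

Definition mulmt (Q : 'M[R]_n) x : n.-tuple R :=
  [tuple \sum_(j < n) Q i j * tnth x j | i < n].

Definition dotr y x : R := dotp x y.

Lemma measurable_dotr y : measurable_fun [set: n.-tuple R] (dotr y).
Proof.
rewrite /dotr /dotp; apply: measurable_sum => i.
by apply: measurable_funM => //; exact: measurable_tnth.
Qed.

HB.instance Definition _ y :=
  isMeasurableFun.Build _ _ _ _ (dotr y) (measurable_dotr y).

End euclidean.

Section random_vector.
Context d (T : measurableType d) (R : realType) (P : probability T R) (n : nat).
Implicit Type X : {RV P >-> n.-tuple R}.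

Definition rvcoord X (i : 'I_n) : T -> R := fun w => tnth (X w) i.

(* The library's expectation of a measurable function is a real number only
   if the function is integrable, so each equation includes integrability. *)
Definition isotropic X : Prop :=
  (forall i, 'E_P[rvcoord X i] = 0)%E /\
  (forall i j,
    'E_P[fun w => (rvcoord X i w * rvcoord X j w)%R] = (i == j)%:R%:E)%E.

Definition finite_third_moment X : Prop :=
  ('E_P[fun w => (norm2 (X w) ^+ 3)%R] < +oo)%E.

Definition spherically_symmetric X : Prop :=
  forall Q : 'M[R]_n, orthogonalmx Q ->
  forall A : set (n.-tuple R), measurable A ->
    distribution P X (mulmt Q @^-1` A) = distribution P X A.

End random_vector.

Definition law_dot d (T : measurableType d) (R : realType)
    (P : probability T R) (n : nat) (X : {RV P >-> n.-tuple R})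
    (y : n.-tuple R) : set R -> \bar R :=
  distribution P (dotr y \o X).

Definition dTV d (T : measurableType d) (R : realType)
    (mu nu : set T -> \bar R) : \bar R :=
  (2%:E * ereal_sup [set `|mu A - nu A| | A in measurable])%E.

(* E[Y | Z] is only defined almost surely; g is one of its versions. *)
Definition is_cond_exp d (T : measurableType d) (R : realType)
    (P : probability T R) (Y Z g : T -> R) : Prop :=
  [/\ measurable_fun [set: g_sigma_algebra_preimageType Z] g,
      P.-integrable [set: T] (EFin \o g) &
      forall A : set T, g_sigma_algebra_preimage Z A ->
        (\int[P]_(w in A) (g w)%:E = \int[P]_(w in A) (Y w)%:E)%E].

Lemma cond_exp_exists d (T : measurableType d) (R : realType)
    (P : probability T R) (Y Z : T -> R) :
  P.-integrable [set: T] (EFin \o Y) -> measurable_fun [set: T] Z ->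
  exists g, is_cond_exp P Y Z g.
Proof.
move=> iY mZ.
pose Z' : {mfun T >-> R} := mfun_Sub (mem_set mZ).
pose nu : {charge set T -> \bar R} := induced_charge iY.
have nuP : nu `<< P.
  apply/null_content_dominatesP => A mA PA0.
  apply: null_set_integral => //; apply: measurable_funTS.
  exact: measurable_int iY.
have dom : pushforward nu Z' `<< distribution P Z'.
  exact: dominates_pushforward.
pose h : R -> \bar R :=
  ltac:(refine (Radon_Nikodym (pushforward nu Z') (distribution P Z'));
        exact: measurable_funP).
have ih : (distribution P Z').-integrable setT h.
  exact: Radon_Nikodym_integrable.
have hfin x : h x \is a fin_num by exact: Radon_Nikodym_fin_num.
have mh : measurable_fun setT h by exact: measurable_int ih.
have ihZ : P.-integrable setT (h \o Z').
  apply/integrableP; split; first exact: measurableT_comp.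
  move/integrableP : ih => [_]; rewrite ge0_integral_pushforward//.
  exact: measurableT_comp.
have gE : EFin \o (fine \o h \o Z) = h \o Z'.
  by apply/funext => w /=; rewrite fineK.
exists (fine \o h \o Z); split.
- move=> _ B mB; rewrite setTI; exists ((fine \o h) @^-1` B).
    rewrite -[X in measurable X]setTI.
    by apply: (measurableT_comp _ mh) => //; exact: fine_measurable.
  by rewrite setTI.
- by rewrite gE.
- move=> A [B mB]; rewrite setTI => <-.
  transitivity (\int[P]_(w in Z' @^-1` B) (h \o Z') w)%E.
    by apply: eq_integral => w _; rewrite -gE.
  rewrite -(integral_pushforward (measurable_funP Z') mh) //; last first.
    apply: (integrableS measurableT) => //.
    by rewrite -[X in measurable X]setTI; exact: measurable_funP.
  exact/esym/(Radon_Nikodym_integral dom).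
Qed.

(* Main.v *)
Require Import Defs.
From HB Require Import structures.
From mathcomp Require Import all_boot all_order all_algebra.
From mathcomp Require Import all_classical all_reals all_analysis.
From mathcomp Require Import measurable_realfun ring lra.

(** The proof is the Stein method for the one-dimensional marginals of a
    rotation invariant law.  Write gamma for the standard Gaussian law, phi for
    its density, and X_1, X_2 for the first two coordinates of X.

    Stein equation.  For a continuous h with values in [0, 1], the function
    f(x) = phi(x)^-1 * int_(-oo)^x (h - gamma(h)) phi solves
    f' - x f = h - gamma(h).  The integrand has total mass 0, so f is also an
    integral over the upper tail, and the tail estimate
    x * int_x^oo phi <= phi(x) gives |x f(x)| <= 1 and |f'| <= 2
    ([stein_solution]).

    Stein identity.  Rotation by a small angle in the plane of X_1 and X_2
    leaves E[X_2 f(X_1)] unchanged; differentiating at angle 0 gives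
    E[X_1 f(X_1)] = E[X_2 ^ 2 f'(X_1)] ([stein_identity]).  Hence, with g a
    version of E[X_2 ^ 2 | X_1],
      E h(X_1) - gamma(h) = E[f'(X_1) - X_1 f(X_1)]
                          = E[(1 - X_2 ^ 2) f'(X_1)] = E[(1 - g) f'(X_1)],
    which is at most 2 E|1 - g| ([stein_bound]).  The law of X_1 may have an
    atom at 0, where f' need not exist for a discontinuous h; this is why h is
    continuous.  Both laws being finite measures, indicators are L^1 limits of
    such h for the sum of the two laws, so the bound passes to every Borel set
    ([distance_le_continuous]).  Finally <X, theta> has the law of X_1, because
    a reflection exchanges theta and the first axis ([law_dot_coord]).

    Norm of X.  Conditionally on X_1 all the other coordinates have the same
    second moment, so (n - 1) (g - 1) is the conditional expectation of
    (|X| ^ 2 - n) - (X_1 ^ 2 - 1); testing it against the sign of g - 1 and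
    using E|X_1 ^ 2 - 1| <= 2 gives the second inequality
    ([cond_exp_norm_bound]).  The third one is the Cauchy-Schwarz inequality
    for |X| ^ 2, whose mean is n ([mean_deviation_le_sd]). *)

Set Implicit Arguments.
Unset Strict Implicit.
Unset Printing Implicit Defensive.

Import Order.TTheory GRing.Theory Num.Theory.
Import numFieldNormedType.Exports.

Local Open Scope classical_set_scope.
Local Open Scope ring_scope.

(** * Integrability of real functions *)

Section real_integrability.
Context d (T : measurableType d) (R : realType).
Context (mu : {measure set T -> \bar R}) (D : set T) (mD : measurable D).
Implicit Types f g : T -> R.

Lemma integrable_mulrl k f : mu.-integrable D (EFin \o f) ->
  mu.-integrable D (EFin \o (fun x => k * f x)).
Proof. by move=> fi; have := integrableZl mD k fi. Qed.

Lemma integrable_addr f g : mu.-integrable D (EFin \o f) ->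
  mu.-integrable D (EFin \o g) ->
  mu.-integrable D (EFin \o (fun x => f x + g x)).
Proof. by move=> fi gi; have := integrableD mD fi gi. Qed.

Lemma integrable_subr f g : mu.-integrable D (EFin \o f) ->
  mu.-integrable D (EFin \o g) ->
  mu.-integrable D (EFin \o (fun x => f x - g x)).
Proof. by move=> fi gi; have := integrableB mD fi gi. Qed.

Lemma integrable_ler g f : mu.-integrable D (EFin \o g) ->
  measurable_fun D f -> (forall x, D x -> `|f x| <= g x) ->
  mu.-integrable D (EFin \o f).
Proof.
move=> gi mf fg; apply: le_integrable gi => //; first exact/measurable_EFinP.
by move=> x Dx /=; rewrite lee_fin (le_trans (fg x Dx))// ler_norm.
Qed.

Lemma EFin_Rintegral f : mu.-integrable D (EFin \o f) ->
  (\int[mu]_(x in D) f x)%:E = (\int[mu]_(x in D) (f x)%:E)%E.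
Proof. by move=> fi; rewrite /Rintegral fineK// integrable_fin_num. Qed.

End real_integrability.

Lemma normr_indic_le1 (T : Type) (R : realType) (A : set T) x :
  `|(\1_A x : R)| <= 1.
Proof. by rewrite indicE; case: (_ \in _); rewrite ?normr1 ?normr0. Qed.

(** * The Gaussian density and the Stein equation *)

Section normal_density.
Context {R : realType}.
Local Notation phi := (normal_pdf (0 : R) 1).
Local Notation mu := (@lebesgue_measure R).

Lemma normal_pdf01E x : phi x = normal_peak 1 * expR (- (2^-1 * x ^+ 2)).
Proof.
rewrite normal_pdfE ?oner_neq0// /normal_fun subr0 expr1n.
by congr (_ * expR _); field.
Qed.

Lemma normal_pdf01_gt0 x : 0 < phi x.
Proof.
by rewrite normal_pdf01E mulr_gt0 ?expR_gt0 ?normal_peak_gt0 ?oner_neq0.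
Qed.

Lemma normal_pdf01N x : phi (- x) = phi x.
Proof. by rewrite !normal_pdf01E sqrrN. Qed.

Lemma is_derive_normal_pdf01 (x : R) : is_derive x 1 phi (- (x * phi x)).
Proof.
have phiE : normal_peak 1 \*: (expR \o - (2^-1 \*: (@id R ^+ 2))) = phi.
  by apply/funext => y; rewrite normal_pdf01E.
rewrite -phiE; apply: is_derive_eq; rewrite phiE.
rewrite normal_pdf01E /GRing.scale/= mulr1 expr1.
have -> : ((- (2^-1 \*: id ^+ 2)) x : R) = - (2^-1 * x ^+ 2) by [].
by field.
Qed.

Lemma cvg_normal_pdf01y : phi x @[x --> +oo%R] --> (0 : R).
Proof.
have -> : phi = fun x => normal_peak 1 * expR (- (2^-1 * x ^+ 2)).
  by apply/funext => y; rewrite normal_pdf01E.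
rewrite -[X in _ --> X](mulr0 (normal_peak 1)).
apply: cvgM; first exact: cvg_cst.
apply: (@cvg_comp _ _ _ (fun x => 2^-1 * x ^+ 2) (fun x => expR (- x)) _
  (pinfty_nbhs R)); last exact: cvgr_expR.
apply: gt0_cvgMry; first by rewrite invr_gt0.
exact: cvgr_expr2.
Qed.

(** The integrand is the derivative of [- phi], which vanishes at infinity. *)
Lemma integral_normal_tail (x : R) : 0 <= x ->
  (\int[mu]_(y in `[x, +oo[) (y * phi y)%:E = (phi x)%:E)%E.
Proof.
move=> x0.
have cphi : continuous phi by apply: continuous_normal_pdf; rewrite oner_neq0.
have := @ge0_continuous_FTC2y R (fun y => y * phi y) (- phi) x 0.
rewrite sub0e -EFinN opprK; apply.
- by move=> y xy; rewrite mulr_ge0 ?normal_pdf_ge0// (le_trans x0).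
- by apply: continuous_subspaceT => y; apply: cvgM; [exact: cvg_id|exact: cphi].
- by rewrite -[X in _ --> X]oppr0; apply: cvgN; exact: cvg_normal_pdf01y.
- by move=> y _; apply: derivableN; have [] := is_derive_normal_pdf01 y.
- by apply: cvgN; apply: cvg_at_right_filter; exact: cphi.
- move=> y _; rewrite derive1E; have := is_derive_normal_pdf01 y => ?.
  by rewrite derive_val opprK.
Qed.

(** On the domain [x <= y], so the left side is at most the integral of
    [y * phi y]. *)
Lemma Rintegral_normal_tailr (x : R) : 0 <= x ->
  x * \int[mu]_(y in `[x, +oo[) phi y <= phi x.
Proof.
move=> x0.
have iphi : mu.-integrable `[x, +oo[ (EFin \o phi).
  by apply: integrableS (integrable_normal_pdf 0 1).
rewrite -RintegralZl// -[leRHS](_ : \int[mu]_(y in `[x, +oo[) (y * phi y) = _);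
  last by rewrite /Rintegral integral_normal_tail.
apply: le_Rintegral => //.
- exact: integrable_mulrl.
- apply/integrableP; split.
    apply/measurable_EFinP/measurable_funTS/measurable_funM => //.
    exact: measurable_normal_pdf.
  under eq_integral => y.
    rewrite inE/= in_itv/= andbT => xy.
    rewrite ger0_norm; last first.
      by rewrite mulr_ge0 ?normal_pdf_ge0// (le_trans x0).
    over.
  by rewrite integral_normal_tail// ltry.
- by move=> y /=; rewrite in_itv/= andbT => xy; rewrite ler_wpM2r ?normal_pdf_ge0.
Qed.

Lemma Rintegral_normal_taill (x : R) : x <= 0 ->
  - x * \int[mu]_(y in `]-oo, x]) phi y <= phi x.
Proof.
move=> x0; rewrite -(normal_pdf01N x).
have -> : \int[mu]_(y in `]-oo, x]) phi y = \int[mu]_(y in `[- x, +oo[) phi y.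
  rewrite /Rintegral -{1}(opprK x) ge0_integration_by_substitutionNy.
  - by congr fine; apply: eq_integral => y _ /=; rewrite normal_pdf01N.
  - by apply/continuous_subspaceT/continuous_normal_pdf; rewrite oner_neq0.
  - by move=> y _; exact: normal_pdf_ge0.
by apply: Rintegral_normal_tailr; rewrite oppr_ge0.
Qed.

End normal_density.

Section stein_equation.
Context {R : realType}.
Local Notation phi := (normal_pdf (0 : R) 1).
Local Notation mu := (@lebesgue_measure R).

Section centered.
Variable k : R -> R.
Hypothesis ck : continuous k.
Hypothesis k1 : forall x, `|k x| <= 1.
Hypothesis k0 : \int[mu]_x (k x * phi x) = 0.

Let kphi x := k x * phi x.

Let F x := \int[mu]_(y in `]-oo, x]) kphi y.

Let continuous_kphi : continuous kphi.
Proof.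
move=> x; apply: cvgM; first exact: ck.
by apply: continuous_normal_pdf; rewrite oner_neq0.
Qed.

Let kphi_le x : `|kphi x| <= phi x.
Proof.
by rewrite normrM (ger0_norm (normal_pdf_ge0 _ _ _)) ler_piMl ?normal_pdf_ge0.
Qed.

Let integrable_kphi D : measurable D -> mu.-integrable D (EFin \o kphi).
Proof.
move=> mD; apply: (@integrable_ler _ _ _ _ _ mD phi).
- by apply: integrableS (integrable_normal_pdf 0 1).
- by apply: measurable_funTS; exact: continuous_measurable_fun.
- by move=> x _; exact: kphi_le.
Qed.

Let norm_kphi_tail D : measurable D ->
  `|\int[mu]_(y in D) kphi y| <= \int[mu]_(y in D) phi y.
Proof.
move=> mD; apply: le_trans (le_normr_Rintegral mD (integrable_kphi mD)) _.
apply: le_Rintegral => //.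
- by apply: integrable_norm; exact: integrable_kphi.
- by apply: integrableS (integrable_normal_pdf 0 1).
Qed.

Let normxF x : `|x * F x| <= phi x.
Proof.
rewrite normrM; have [x0|x0] := leP x 0.
  rewrite (le_trans _ (Rintegral_normal_taill x0))// ler0_norm//.
  by rewrite ler_wpM2l ?oppr_ge0// norm_kphi_tail.
rewrite (le_trans _ (Rintegral_normal_tailr (ltW x0)))// gtr0_norm//.
rewrite ler_wpM2l ?(ltW x0)//.
have -> : F x = - \int[mu]_(y in `[x, +oo[) kphi y.
  have := @Rintegral_itvB R kphi -oo%O +oo%O x.
  rewrite set_itvNyy => /(_ (integrable_kphi measurableT) isT isT).
  rewrite -/(F x) {1}/kphi k0 sub0r Rintegral_itv_obnd_cbnd.
    by move=> <-; rewrite opprK.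
  exact: integrable_kphi.
by rewrite normrN norm_kphi_tail.
Qed.

Let is_derive_F (x : R) : is_derive x 1 F (kphi x).
Proof.
have := @continuous_FTC1 R kphi -oo%O x (x + 1 : R).
rewrite ltrDl => /(_ ltr01 (integrable_kphi _)).
case => //; last first.
  by move=> dF FE; rewrite -FE derive1E; exact: derivableP.
- exact: continuous_kphi.
- exact: ltNyr.
Qed.

(** The solution is [F / phi], where [F] integrates [k * phi] up to [x].  Its
    derivative is [k x + x * f x], and both terms are bounded by 1: [k] by
    hypothesis, [x * f x] by the Gaussian tail estimate.  For positive [x] that
    estimate concerns the upper tail, which [k0] makes equal to [- F x]. *)
Lemma stein_solution_centered : exists f f' : R -> R,
  [/\ forall x : R, is_derive x 1 f (f' x), continuous f',
      forall x, `|f' x| <= 2 & forall x, f' x - x * f x = k x].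
Proof.
have phi0 x : phi x != 0 by rewrite gt_eqF ?normal_pdf01_gt0.
pose f x := F x / phi x.
have df (x : R) : is_derive x 1 f (k x + x * f x).
  have dV : is_derive x 1 (fun y => (phi y)^-1) (- (phi x) ^- 2 *: - (x * phi x)).
    by apply: is_deriveV => //; exact: is_derive_normal_pdf01.
  have dM := is_deriveM (is_derive_F x) dV.
  apply: is_derive_eq dM _; rewrite /f /kphi /GRing.scale/=.
  by field.
exists f, (fun x => k x + x * f x); split => //.
- move=> x; apply: cvgD; first exact: ck.
  apply: cvgM; first exact: cvg_id.
  by apply: differentiable_continuous; apply/derivable1_diffP; have [] := df x.
- move=> x; rewrite (le_trans (ler_normD _ _))// -[2]/(1 + 1) lerD//.
  rewrite /f mulrA normrM normfV (ger0_norm (normal_pdf_ge0 _ _ _)).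
  by rewrite ler_pdivrMr ?normal_pdf01_gt0// mul1r.
- by move=> x; rewrite addrK.
Qed.

End centered.
End stein_equation.

(** * Bounded functions and finite measures *)

Section finite_measure_integrability.
Context d (T : measurableType d) (R : realType).
Context (m : {finite_measure set T -> \bar R}).
Implicit Types f : T -> R.

Lemma integrable_boundedr M f : measurable_fun setT f ->
  (forall x, `|f x| <= M) -> m.-integrable setT (EFin \o f).
Proof.
move=> mf fM; apply: (integrable_ler _ (g := cst M)) => //.
exact: finite_measure_integrable_cst.
Qed.

Lemma Rintegral_indic A : measurable A -> \int[m]_x (\1_A x) = fine (m A).
Proof. by move=> mA; rewrite /Rintegral integral_indic// setIT. Qed.

Lemma bounded_cvg0_Rintegral M (f_ : nat -> T -> R) (e : R) : 0 < e ->
  (forall n, measurable_fun setT (f_ n)) -> (forall n x, `|f_ n x| <= M) ->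
  (forall x, f_ n x @[n --> \oo] --> (0 : R)) ->
  exists n, \int[m]_x `|f_ n x| <= e.
Proof.
move=> e0 mf fM f0.
have [|||||_ + _] := @dominated_convergence _ _ _ m setT measurableT
  (fun n x => (f_ n x)%:E) (cst 0%E) (cst M%:E).
- by move=> n; exact/measurable_EFinP.
- exact: measurable_cst.
- apply: aeW => x _; apply/fine_cvgP; split; first exact: nearW.
  exact: f0.
- exact: finite_measure_integrable_cst.
- by apply: aeW => x n _; rewrite lee_fin.
under eq_fun => n do under eq_integral => x _ do rewrite sube0 abse_EFin.
move=> /fine_cvgP[_].
move/cvgrPdist_le => /(_ e e0)[N _ /(_ N (leqnn _))/=].
rewrite sub0r normrN => He; exists N.
by apply: le_trans He; rewrite ler_norm.
Qed.

End finite_measure_integrability.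

Lemma Rintegral_cst_prob d (T : measurableType d) (R : realType)
  (P : probability T R) (r : R) : \int[P]_x (cst r x) = r.
Proof.
rewrite Rintegral_cst// [fine _](_ : _ = 1) ?mulr1//.
exact: (congr1 fine (probability_setT P)).
Qed.

Section bounded_functional.
Context d (T : measurableType d) (R : realType).
Variables (D : (T -> R) -> R) (C : R).
Hypothesis D_add_indic : forall (f : T -> R) M a A, measurable_fun setT f ->
  (forall x, `|f x| <= M) -> measurable A ->
  D (fun x => f x + a * \1_A x) = D f.
Hypothesis D_bounded : forall (f : T -> R) M, measurable_fun setT f ->
  (forall x, `|f x| <= M) -> `|D f| <= C * M.

(** Subtracting [M / 2] where [f] is nonnegative and adding it elsewhere halves
    the bound on [f] and leaves [D f] unchanged.  Iterating, [D f] is at most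
    [C * M / 2 ^+ k] for every [k]. *)
Lemma bounded_functional_eq0 (f : T -> R) M : measurable_fun setT f ->
  (forall x, `|f x| <= M) -> D f = 0.
Proof.
move=> mf fM.
suff DfM k : `|D f| <= C * M / 2 ^+ k.
  apply/eqP; rewrite -normr_le0; apply/ler_addgt0Pr => e e0; rewrite add0r.
  have : geometric (C * M) (2^-1) n @[n --> \oo] --> 0.
    by apply: cvg_geometric; rewrite ger0_norm// invf_lt1// ltr1n.
  move/cvgrPdist_le => /(_ e e0)[N _ /(_ N (leqnn _))/=].
  rewrite sub0r normrN; apply: le_trans; apply: le_trans (ler_norm _).
  by rewrite exprVn; exact: DfM.
elim: k f M mf fM => [|k IH] f M mf fM; first by rewrite expr0 divr1 D_bounded.
pose A := [set x | 0 <= f x].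
have mA : measurable A.
  rewrite -[A]setTI; apply: measurable_fun_le => //; exact: measurable_cst.
(* [f - M / 2] on [A] and [f + M / 2] off [A] is [f + M / 2 - M * \1_A]. *)
pose f1 x := f x + (M / 2) * \1_setT x.
have mf1 : measurable_fun setT f1.
  by apply: measurable_funD => //; apply: measurable_funM.
have f1M x : `|f1 x| <= M + `|M / 2|.
  by rewrite /f1 indicT mulr1 (le_trans (ler_normD _ _))// lerD.
rewrite -(D_add_indic (M / 2) mf fM measurableT) -/f1.
rewrite -(D_add_indic (- M) mf1 f1M mA).
rewrite exprS invfM !mulrA -[C * M * 2^-1]mulrA; apply: IH.
  by apply: measurable_funD => //; apply: measurable_funM.
move=> x; have := fM x; rewrite /f1 indicT indicE mulr1 ler_norml => /andP[lx ux].
have [xA|xA] := boolP (x \in A).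
  move: xA; rewrite inE/A/= => xA.
  by rewrite mulr1 ler_norml; apply/andP; split; lra.
have {}xA : f x < 0 by rewrite ltNge; apply: contra xA; rewrite inE.
by rewrite mulr0 addr0 ler_norml; apply/andP; split; lra.
Qed.

End bounded_functional.

Section stein_solution.
Context {R : realType}.
Local Notation phi := (normal_pdf (0 : R) 1).
Local Notation gamma := (normal_prob (0 : R) 1).
Local Notation mu := (@lebesgue_measure R).

Lemma integrable_bounded_normal_pdf M (f : R -> R) : measurable_fun setT f ->
  (forall x, `|f x| <= M) ->
  mu.-integrable setT (EFin \o (fun x => f x * phi x)).
Proof.
move=> mf fM; apply: (@integrable_ler _ _ _ mu _ measurableT
  (fun x => M * phi x)) => //.
- by apply: integrable_mulrl => //; exact: integrable_normal_pdf.
- by apply: measurable_funM => //; exact: measurable_normal_pdf.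
- by move=> x _; rewrite normrM (ger0_norm (normal_pdf_ge0 _ _ _)) ler_wpM2r
    ?normal_pdf_ge0.
Qed.

(** The difference of the two sides is a functional to which
    [bounded_functional_eq0] applies: on indicators it vanishes by definition
    of the measure. *)
Lemma Rintegral_normal_prob M (f : R -> R) : measurable_fun setT f ->
  (forall x, `|f x| <= M) -> \int[gamma]_x f x = \int[mu]_x (f x * phi x).
Proof.
move=> mf fM; apply/eqP; rewrite -subr_eq0; apply/eqP.
apply: (@bounded_functional_eq0 _ _ _
  (fun f => \int[gamma]_x f x - \int[mu]_x (f x * phi x)) 2 _ _ f M) => //.
- move=> {}f {}M a A {}mf {}fM mA.
  have m1 : measurable_fun setT (\1_A : R -> R) by [].
  have b1 := @normr_indic_le1 _ R A.
  rewrite RintegralD//; last 2 first.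
    exact: integrable_boundedr fM.
    by apply: integrable_mulrl => //; exact: integrable_boundedr b1.
  rewrite RintegralZl//; last exact: integrable_boundedr b1.
  rewrite Rintegral_indic//.
  under [X in _ - X]eq_Rintegral do rewrite mulrDl -mulrA.
  rewrite RintegralD//; last 2 first.
    exact: integrable_bounded_normal_pdf fM.
    by apply: integrable_mulrl => //; exact: integrable_bounded_normal_pdf b1.
  rewrite RintegralZl//; last exact: integrable_bounded_normal_pdf b1.
  suff -> : fine (gamma A) = \int[mu]_x (\1_A x * phi x) by ring.
  rewrite /Rintegral; congr fine; rewrite [LHS]integral_mkcond.
  apply: eq_integral => x _; rewrite patchE indicE.
  by case: ifP; rewrite ?mul1r ?mul0r.
- move=> {}f {}M {}mf {}fM.
  rewrite (le_trans (ler_normB _ _))// mulrDl !mul1r lerD//.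
    rewrite (le_trans (le_normr_Rintegral _ (integrable_boundedr _ mf fM)))//.
    rewrite (le_trans (le_Rintegral (f2 := cst M) _ _ _ _))//.
    + exact/integrable_norm/integrable_boundedr/fM.
    + exact: finite_measure_integrable_cst.
    + by rewrite Rintegral_cst_prob.
  have i1 := integrable_bounded_normal_pdf mf fM.
  apply: le_trans (le_normr_Rintegral _ i1) _ => //.
  have -> : M = \int[mu]_x (M * phi x).
    rewrite RintegralZl//; last exact: integrable_normal_pdf.
    by rewrite /Rintegral integral_normal_pdf mulr1.
  apply: le_Rintegral => //.
  + exact: integrable_norm.
  + by apply: integrable_mulrl => //; exact: integrable_normal_pdf.
  + by move=> x _; rewrite normrM (ger0_norm (normal_pdf_ge0 _ _ _)) ler_wpM2r
      ?normal_pdf_ge0.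
Qed.

Lemma stein_solution (h : R -> R) : continuous h -> (forall x, 0 <= h x <= 1) ->
  exists f f' : R -> R,
  [/\ forall x : R, is_derive x 1 f (f' x), continuous f',
      forall x, `|f' x| <= 2 &
      forall x, f' x - x * f x = h x - \int[gamma]_y h y].
Proof.
move=> ch h01; set p := \int[gamma]_y h y.
have mh : measurable_fun setT h by exact: continuous_measurable_fun.
have hM x : `|h x| <= 1 by have /andP[h0 h1] := h01 x; rewrite ger0_norm.
have ih : gamma.-integrable setT (EFin \o h).
  exact: (@integrable_boundedr _ _ _ (normal_prob 0 1) 1 h mh hM).
have p0 : 0 <= p by apply: Rintegral_ge0 => x _; have /andP[] := h01 x.
have p1 : p <= 1.
  rewrite -[leRHS](Rintegral_cst_prob gamma); apply: le_Rintegral => //.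
    exact: finite_measure_integrable_cst.
  by move=> x _; have /andP[] := h01 x.
have k1 x : `|h x - p| <= 1.
  by have /andP[h0 h1] := h01 x; rewrite ler_norml; apply/andP; split; lra.
have mk : measurable_fun setT (fun x => h x - p).
  by apply: measurable_funB => //; exact: measurable_cst.
apply: (@stein_solution_centered _ (fun x => h x - p)) => //.
  by move=> x; apply: cvgB; [exact: ch|exact: cvg_cst].
rewrite -(Rintegral_normal_prob mk k1) RintegralB//; last first.
  exact: finite_measure_integrable_cst.
by rewrite -/p Rintegral_cst_prob subrr.
Qed.

End stein_solution.

(** * Approximation of Borel sets by continuous functions *)

Section continuous_approximation.
Context {R : realType}.
Variable m : {finite_measure set (measurableTypeR R) -> \bar R}.

Definition L1_approximable (u : R -> R) := forall e : R, 0 < e ->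
  exists h : R -> R, [/\ continuous h, forall x, 0 <= h x <= 1 &
                         \int[m]_x `|h x - u x| <= e].

Let unit_fun (u : R -> R) :=
  measurable_fun setT u /\ forall x, 0 <= u x <= 1.

Let unit_distE (u v : R -> R) : unit_fun u -> unit_fun v ->
  measurable_fun setT (fun x => u x - v x) /\ forall x, `|u x - v x| <= 1.
Proof.
move=> [mu u01] [mv v01]; split; first exact: measurable_funB.
move=> x; have /andP[u0 u1] := u01 x; have /andP[v0 v1] := v01 x.
by rewrite ler_norml; apply/andP; split; lra.
Qed.

Let integrable_unit_dist (u v : R -> R) : unit_fun u -> unit_fun v ->
  m.-integrable setT (EFin \o (fun x => `|u x - v x|)).
Proof.
move=> uu uv; have [muv uv1] := unit_distE uu uv.
have := integrable_norm (@integrable_boundedr _ _ _ m _ _ muv uv1).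
exact.
Qed.

Let unit_cont (h : R -> R) : continuous h -> (forall x, 0 <= h x <= 1) ->
  unit_fun h.
Proof. by move=> ch h01; split => //; exact: continuous_measurable_fun. Qed.

Let unit_indic (A : set R) : measurable A -> unit_fun (\1_A).
Proof.
by move=> mA; split => // x; rewrite indicE; case: (_ \in _); rewrite lexx ler01.
Qed.

Lemma L1_approximable_continuous (h : R -> R) : continuous h ->
  (forall x, 0 <= h x <= 1) -> L1_approximable h.
Proof.
move=> ch h01 e e0; exists h; split => //.
rewrite (@eq_Rintegral _ _ _ m setT (cst 0)); last first.
  by move=> x _; rewrite subrr normr0.
by rewrite Rintegral_cst// mul0r ltW.
Qed.

Let L1_approximable_lim (u_ : nat -> R -> R) (u : R -> R) :
  (forall n, unit_fun (u_ n)) -> unit_fun u ->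
  (forall n, L1_approximable (u_ n)) ->
  (forall x, u_ n x @[n --> \oo] --> u x) -> L1_approximable u.
Proof.
move=> uu_ uu au_ cu e e0.
have e20 : 0 < e / 2 by rewrite divr_gt0.
have [n un] : exists n, \int[m]_x `|u_ n x - u x| <= e / 2.
  apply: (@bounded_cvg0_Rintegral _ _ _ m 1 (fun n x => u_ n x - u x)) => //.
  - by move=> n; have [] := unit_distE (uu_ n) uu.
  - by move=> n; have [] := unit_distE (uu_ n) uu.
  - by move=> x; rewrite -(subrr (u x)); apply: cvgB; [exact: cu|exact: cvg_cst].
have [h [ch h01 hu]] := au_ n _ e20; exists h; split => //.
have uh := unit_cont ch h01.
rewrite (splitr e) (le_trans _ (lerD hu un))// -RintegralD//; last 2 first.
  exact: integrable_unit_dist.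
  exact: integrable_unit_dist.
apply: le_Rintegral => //.
- exact: integrable_unit_dist.
- by apply: integrable_addr => //; exact: integrable_unit_dist.
- by move=> x _; rewrite -{1}(subrKA (u_ n x)) ler_normD.
Qed.

Let L1_approximableU (A B : set R) : measurable A -> measurable B ->
  L1_approximable (\1_A) -> L1_approximable (\1_B) -> L1_approximable (\1_(A `|` B)).
Proof.
move=> mA mB aA aB e e0.
have e20 : 0 < e / 2 by rewrite divr_gt0.
have [h [ch h01 hA]] := aA _ e20; have [k [ck k01 kB]] := aB _ e20.
have uh := unit_cont ch h01; have uk := unit_cont ck k01.
have chk : continuous (fun x => Num.max (h x) (k x)).
  by move=> x; apply: continuous_max; [exact: ch|exact: ck].
have hk01 x : 0 <= Num.max (h x) (k x) <= 1.
  have /andP[h0 h1] := h01 x; have /andP[k0 k1] := k01 x.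
  by rewrite le_max h0 ge_max h1 k1.
exists (fun x => Num.max (h x) (k x)); split => //.
rewrite (splitr e) (le_trans _ (lerD hA kB))// -RintegralD//; last 2 first.
  by apply: integrable_unit_dist => //; exact: unit_indic.
  by apply: integrable_unit_dist => //; exact: unit_indic.
apply: le_Rintegral => //.
- by apply: integrable_unit_dist; [exact: unit_cont|
    apply: unit_indic; exact: measurableU].
- by apply: integrable_addr => //; apply: integrable_unit_dist => //;
    exact: unit_indic.
- move=> x _; have /andP[h0 h1] := h01 x; have /andP[k0 k1] := k01 x.
  have normB1 t : t <= 1 -> `|t - 1| = 1 - t.
    by move=> t1; rewrite ler0_norm ?opprB// subr_le0.
  rewrite !indicE in_setU; case: (x \in A); case: (x \in B) => /=;
    case: (leP (h x) (k x)) => hk; rewrite ?mulr0n ?mulr1n ?subr0 ?normB1//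
      ?(ger0_norm h0) ?(ger0_norm k0); lra.
Qed.

Let L1_approximable0 : L1_approximable (\1_set0).
Proof.
rewrite indic0; apply: L1_approximable_continuous; first by move=> x; exact: cvg_cst.
by move=> x; rewrite lexx ler01.
Qed.

Let L1_approximableC (A : set R) :
  L1_approximable (\1_A) -> L1_approximable (\1_(~` A)).
Proof.
move=> aA e e0; have [h [ch h01 hA]] := aA _ e0.
exists (fun x => 1 - h x); split.
- by move=> x; apply: cvgB; [exact: cvg_cst|exact: ch].
- by move=> x; have /andP[h0 h1] := h01 x; rewrite subr_ge0 h1 lerBlDr lerDl.
- rewrite (@eq_Rintegral _ _ _ m setT (fun x => `|h x - \1_A x|))// => x _.
  rewrite !indicE in_setC; case: (x \in A) => /=.
    by rewrite subr0 distrC.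
  by rewrite addrAC subrr sub0r normrN subr0.
Qed.

Let L1_approximable_bigcup (A : nat -> set R) : (forall n, measurable (A n)) ->
  (forall n, L1_approximable (\1_(A n))) -> L1_approximable (\1_(\bigcup_n A n)).
Proof.
move=> mA aA; pose U n := \big[setU/set0]_(i < n) A i.
have mU n : measurable (U n) by exact: bigsetU_measurable.
apply: (@L1_approximable_lim (fun n => \1_(U n))).
- by move=> n; exact: unit_indic.
- by apply: unit_indic; exact: bigcup_measurable.
- elim=> [|n IH]; first by rewrite /U big_ord0; exact: L1_approximable0.
  rewrite /U big_ord_recr/=; apply: L1_approximableU => //; exact: mU.
- move=> x; apply: (@cvg_trans _ ((cst (\1_(\bigcup_n A n) x : R)) @ \oo));
    last exact: cvg_cst.
  apply: near_eq_cvg; have [[N _ AN]|nA] := pselect ((\bigcup_n A n) x).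
    exists N.+1 => // n /= Nn; rewrite !indicE !mem_set//; last by exists N.
    by rewrite /U -bigcup_mkord; exists N.
  apply: nearW => n; rewrite !indicE !memNset// => Ux; apply: nA.
  by move: Ux; rewrite /U -bigcup_mkord => -[i _ Ai]; exists i.
Qed.

Let L1_approximable_ray (a : R) : L1_approximable (\1_(`]a, +oo[)).
Proof.
pose u n (x : R) := Num.max 0 (Num.min 1 (n%:R * (x - a))).
have cu n : continuous (u n).
  move=> x; have c0 c : {for x, continuous (@cst R R c)} by exact: cvg_cst.
  have cv : {for x, continuous (fun x => n%:R * (x - a))}.
    apply: cvgM; first exact: cvg_cst.
    by apply: cvgB; [exact: cvg_id|exact: cvg_cst].
  exact: (continuous_max (c0 0) (continuous_min (c0 1) cv)).
have u01 n x : 0 <= u n x <= 1.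
  by rewrite le_max lexx ge_max ler01 ge_min lexx.
apply: (@L1_approximable_lim u).
- by move=> n; exact: unit_cont.
- exact: unit_indic.
- by move=> n; exact: L1_approximable_continuous.
- move=> x; apply: (@cvg_trans _ ((cst (\1_(`]a, +oo[) x : R)) @ \oo));
    last exact: cvg_cst.
  apply: near_eq_cvg; have [xa|ax] := leP x a.
    apply: nearW => n; rewrite indicE memNset/=; last first.
      by rewrite in_itv/= andbT => ax; rewrite ltNge xa in ax.
    have nxa : n%:R * (x - a) <= 0 by rewrite mulr_ge0_le0// subr_le0.
    by apply/esym/max_idPl; rewrite ge_min nxa orbT.
  have xa0 : 0 < x - a by rewrite subr_gt0.
  exists (Num.bound (x - a)^-1) => // n /= Nn.
  rewrite indicE mem_set/=; last by rewrite in_itv/= ax.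
  rewrite /u (min_idPl _) ?max_r// -ler_pdivrMr// div1r.
  apply: le_trans (ltW (archi_boundP _)) _; first by rewrite invr_ge0 ltW.
  by rewrite ler_nat.
Qed.

(** The Borel sets with this property form a sigma-algebra: complements
    correspond to [1 - h], finite unions to the maximum of two functions, and
    countable unions are limits of finite ones.  It contains the open rays,
    whose indicators are limits of truncated affine functions. *)
Lemma L1_approximable_indic (A : set R) : measurable A -> L1_approximable (\1_A).
Proof.
suff : measurable `<=` [set A : set R | measurable A /\ L1_approximable (\1_A)].
  by move=> mc /mc[].
rewrite [X in X `<=` _](RGenOInfty.measurableE R).
apply: smallest_sub; last first.
  by move=> _ [a ->]; split; [exact: measurable_itv|exact: L1_approximable_ray].
split.
- by split => //; exact: L1_approximable0.
- move=> B [mB aB]; rewrite setTD; split; first exact: measurableC.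
  exact: L1_approximableC.
- move=> B mcB; split; first by apply: bigcup_measurable => n _; have [] := mcB n.
  by apply: L1_approximable_bigcup => n; have [] := mcB n.
Qed.

End continuous_approximation.

Section finite_msum.
Context d (T : measurableType d) (R : realType).
Variables (m_ : {finite_measure set T -> \bar R}^nat) (n : nat).

Let msum_finite : fin_num_fun (msum (fun i => m_ i) n).
Proof.
move=> A mA; rewrite /msum sum_fin_num; apply/allP => _ /mapP[i _ ->].
exact: fin_num_measure.
Qed.

HB.instance Definition _ :=
  @Measure_isFinite.Build d T R (msum (fun i => m_ i) n) msum_finite.

End finite_msum.

Section continuous_test_functions.
Context {R : realType}.
Variables (m1 m2 : {finite_measure set (measurableTypeR R) -> \bar R}) (K : R).
Hypothesis mK : forall h : R -> R, continuous h -> (forall x, 0 <= h x <= 1) ->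
  `|\int[m1]_x h x - \int[m2]_x h x| <= K.

(** The indicator of [A] is approximated with respect to [m1 + m2], hence for
    both measures by the same test function. *)
Lemma distance_le_continuous A : measurable A ->
  `|fine (m1 A) - fine (m2 A)| <= K.
Proof.
move=> mA; apply/ler_addgt0Pr => e e0.
pose m_ i : {finite_measure set (measurableTypeR R) -> \bar R} :=
  if i is 0%N then m1 else m2.
have [h [ch h01 hA]] := @L1_approximable_indic _ (msum (fun i => m_ i) 2) A mA e e0.
have h1 x : `|h x| <= 1 by have /andP[h0 h1] := h01 x; rewrite ger0_norm.
have A1 := @normr_indic_le1 _ R A.
have mh : measurable_fun setT h by exact: continuous_measurable_fun.
have mi : measurable_fun setT (\1_A : R -> R) by [].
have mhA : measurable_fun setT (fun x => `|h x - \1_A x|).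
  by apply: measurableT_comp => //; exact: measurable_funB.
have dE (m : {finite_measure set (measurableTypeR R) -> \bar R}) :
    `|\int[m]_x h x - fine (m A)| <= \int[m]_x `|h x - \1_A x| /\
    m.-integrable setT (EFin \o (fun x => `|h x - \1_A x|)).
  have ih := integrable_boundedr m mh h1.
  have iA := integrable_boundedr m mi A1.
  rewrite -Rintegral_indic// -RintegralB//; split.
    by apply: le_normr_Rintegral => //; exact: integrable_subr.
  by have := integrable_norm (integrable_subr measurableT ih iA).
have addE : \int[msum (fun i => m_ i) 2]_x `|h x - \1_A x| =
    \int[m1]_x `|h x - \1_A x| + \int[m2]_x `|h x - \1_A x|.
  rewrite {1}/Rintegral ge0_integral_measure_sum//; last first.
    exact/measurable_EFinP.
  rewrite 2!big_ord_recl big_ord0 adde0/=.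
  by rewrite fineD// integrable_fin_num//; exact: (dE _).2.
have := mK ch h01; have := (dE m1).1; have := (dE m2).1.
move: hA; rewrite addE !ler_norml.
set I1 := \int[m1]_x `|_|; set I2 := \int[m2]_x `|_|.
move=> ? /andP[? ?] /andP[? ?] /andP[? ?]; apply/andP; split; lra.
Qed.

End continuous_test_functions.

(** * Reflections and spherical symmetry *)

Section householder.
Context {R : realType} {n : nat}.
Implicit Types (v x : n.-tuple R) (i k : 'I_n).

Lemma dotpC x v : dotp x v = dotp v x.
Proof. by apply: eq_bigr => i _; rewrite mulrC. Qed.

Lemma sum_delta i (F : 'I_n -> R) : \sum_(j < n) (j == i)%:R * F j = F i.
Proof.
rewrite (bigD1 i)//= eqxx mul1r big1 ?addr0// => j ji.
by rewrite (negbTE ji) mul0r.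
Qed.

Definition householder v : 'M[R]_n :=
  \matrix_(i, j) ((j == i)%:R - 2 / dotp v v * tnth v i * tnth v j).

(** For [v = 0] the convention [0^-1 = 0] makes the matrix the identity;
    otherwise it is the reflection along [v]. *)
Lemma orthogonal_householder v : orthogonalmx (householder v).
Proof.
apply/matrixP => i j; rewrite !mxE.
set c := 2 / dotp v v.
have cE : c * c * dotp v v = 2 * c.
  rewrite /c; have [->|v0] := eqVneq (dotp v v) 0; last by field.
  by rewrite invr0 !mulr0.
transitivity (\sum_(k < n) ((k == i)%:R * (k == j)%:R
  - c * tnth v j * ((k == i)%:R * tnth v k)
  - c * tnth v i * ((k == j)%:R * tnth v k)
  + c * c * tnth v i * tnth v j * (tnth v k * tnth v k))).
  by apply: eq_bigr => k _; rewrite !mxE -/c; ring.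
rewrite big_split/= !sumrB -!mulr_sumr !sum_delta -/(dotp v v).
have -> : c * c * tnth v i * tnth v j * dotp v v =
  (c * c * dotp v v) * tnth v i * tnth v j by ring.
by rewrite cE; ring.
Qed.

Lemma tnth_householder v x i :
  tnth (mulmt (householder v) x) i =
  tnth x i - 2 * dotp v x / dotp v v * tnth v i.
Proof.
rewrite tnth_mktuple.
transitivity (\sum_(k < n) ((k == i)%:R * tnth x k -
   2 / dotp v v * tnth v i * (tnth v k * tnth x k))).
  by apply: eq_bigr => k _; rewrite mxE; ring.
by rewrite sumrB -mulr_sumr -/(dotp v x) sum_delta; ring.
Qed.

(** The vector [a e_i - e_k].  The reflection along it acts in the plane of the
    axes [i] and [k]; in that plane it is a rotation, of angle tending to 0 with
    [a], composed with a sign change of the coordinate [k].  For [a = 1] it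
    exchanges the two coordinates. *)
Definition axis_vect (a : R) i k : n.-tuple R :=
  [tuple a * (j == i)%:R - (j == k)%:R | j < n].

Lemma dotp_axis_vect a i k x : dotp (axis_vect a i k) x = a * tnth x i - tnth x k.
Proof.
rewrite /dotp -[tnth x i](sum_delta _ (tnth x)) -[tnth x k](sum_delta _ (tnth x)).
rewrite mulr_sumr -sumrB; apply: eq_bigr => j _.
by rewrite tnth_mktuple; ring.
Qed.

Definition axis_reflection a i k := householder (axis_vect a i k).

Lemma tnth_axis_reflection a i k j x : i != k ->
  tnth (mulmt (axis_reflection a i k) x) j =
  tnth x j - 2 * (a * tnth x i - tnth x k) / (1 + a ^+ 2) *
             (a * (j == i)%:R - (j == k)%:R).
Proof.
move=> ik; rewrite tnth_householder !dotp_axis_vect !tnth_mktuple.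
have ki : (k == i) = false by rewrite eq_sym; exact: negbTE.
rewrite !eqxx (negbTE ik) ki !mulr0 !mulr1 subr0 sub0r opprK.
by rewrite -expr2 [a ^+ 2 + 1]addrC.
Qed.

Lemma axis_reflection_fst a i k x : i != k ->
  tnth (mulmt (axis_reflection a i k) x) i =
  (1 - a ^+ 2) / (1 + a ^+ 2) * tnth x i + 2 * a / (1 + a ^+ 2) * tnth x k.
Proof.
move=> ik; rewrite tnth_axis_reflection// eqxx (negbTE ik)/= mulr1 subr0.
have a0 : 1 + a ^+ 2 != 0 by rewrite gt_eqF// ltr_pwDl// sqr_ge0.
by field.
Qed.

Lemma axis_reflection_snd a i k x : i != k ->
  tnth (mulmt (axis_reflection a i k) x) k =
  2 * a / (1 + a ^+ 2) * tnth x i - (1 - a ^+ 2) / (1 + a ^+ 2) * tnth x k.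
Proof.
move=> ik; have ki : (k == i) = false by rewrite eq_sym; exact: negbTE.
rewrite tnth_axis_reflection// eqxx ki/= mulr0 sub0r.
have a0 : 1 + a ^+ 2 != 0 by rewrite gt_eqF// ltr_pwDl// sqr_ge0.
by field.
Qed.

(** The reflection exchanging [theta] and the [i]-th axis; when they coincide,
    the vector [theta - e_i] is 0 and the matrix is the identity. *)
Lemma exists_orthogonal_fst theta i : sphere theta ->
  exists2 Q : 'M[R]_n, orthogonalmx Q &
    forall x, tnth (mulmt Q x) i = dotp theta x.
Proof.
rewrite /sphere/= => theta1.
have tt1 : dotp theta theta = 1.
  have tt0 : 0 <= dotp theta theta.
    by apply: sumr_ge0 => j _; rewrite -expr2 sqr_ge0.
  by rewrite -(sqr_sqrtr tt0) -/(norm2 theta) theta1 expr1n.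
pose v : n.-tuple R := [tuple tnth theta j - (j == i)%:R | j < n].
have vx x : dotp v x = dotp theta x - tnth x i.
  rewrite /dotp -(sum_delta i (tnth x)) -sumrB; apply: eq_bigr => j _.
  by rewrite tnth_mktuple; ring.
have vv : dotp v v = 2 - 2 * tnth theta i.
  by rewrite vx dotpC vx tt1 tnth_mktuple eqxx/=; ring.
exists (householder v); first exact: orthogonal_householder.
move=> x; rewrite tnth_householder vx tnth_mktuple eqxx/=.
have [v0|v0] := eqVneq (dotp v v) 0.
  have vj j : tnth v j = 0.
    move: v0; rewrite /dotp => /eqP; rewrite psumr_eq0.
      by move=> /allP/(_ j (mem_index_enum _)) /=; rewrite mulf_eq0 orbb => /eqP.
    by move=> l _; rewrite -expr2 sqr_ge0.
  have : dotp v x = 0 by rewrite /dotp big1// => j _; rewrite vj mul0r.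
  rewrite vx => /eqP; rewrite subr_eq0 => /eqP ->.
  by rewrite subrr mulr0 !mul0r subr0.
rewrite vv; move: v0; rewrite vv => v0.
have ti : 1 - tnth theta i != 0.
  by apply: contraNneq v0 => /eqP; rewrite subr_eq0 => /eqP <-; rewrite mulr1 subrr.
by field; rewrite v0.
Qed.

Lemma measurable_mulmt (Q : 'M[R]_n) : measurable_fun setT (mulmt Q).
Proof.
apply/measurable_fun_tnthP => i; rewrite (_ : _ \o _ =
    fun x => \sum_(j < n) Q i j * tnth x j); last first.
  by apply/funext => x /=; rewrite tnth_mktuple.
apply: measurable_sum => j; apply: measurable_funM => //.
exact: measurable_tnth.
Qed.

End householder.

Section spherical_symmetry.
Context d (T : measurableType d) (R : realType) (P : probability T R) (n : nat).
Variable X : {RV P >-> n.-tuple R}.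
Hypothesis hsph : spherically_symmetric X.

(** The integrals are taken against the images of [P] under [mulmt Q \o X] and
    [X], which are the same measure. *)
Lemma spherical_Rintegral (Q : 'M[R]_n) (phi : n.-tuple R -> R) :
  orthogonalmx Q -> measurable_fun setT phi ->
  P.-integrable setT (EFin \o (phi \o X)) ->
  P.-integrable setT (EFin \o (phi \o mulmt Q \o X)) /\
  \int[P]_w phi (mulmt Q (X w)) = \int[P]_w phi (X w).
Proof.
move=> Qo mphi iphi; pose Y := mulmt Q \o X.
have mX : measurable_fun setT X by exact: measurable_funP.
have mY : measurable_fun setT Y.
  by apply: measurableT_comp mX; exact: measurable_mulmt.
have PXY (f : n.-tuple R -> \bar R) :
    (\int[pushforward P Y]_y f y = \int[pushforward P X]_y f y)%E.
  apply: eq_measure_integral => A mA _; exact: hsph.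
have mEphi : measurable_fun setT (EFin \o phi) by exact/measurable_EFinP.
have iY : P.-integrable setT (EFin \o (phi \o Y)).
  apply/integrableP; split; first exact/measurable_EFinP/measurableT_comp.
  have /integrableP[_] := iphi.
  have mabs : measurable_fun setT (abse \o (EFin \o phi)) by exact: measurableT_comp.
  have abs0 : {in [set: n.-tuple R],
      forall x, (0 <= (abse \o (EFin \o phi)) x)%E}.
    by move=> x _; exact: abse_ge0.
  have := PXY (abse \o (EFin \o phi)).
  rewrite (ge0_integral_pushforward mY)// (ge0_integral_pushforward mX)//.
  by rewrite !preimage_setT => ->.
split => //; rewrite /Rintegral; congr fine.
have := PXY (EFin \o phi).
by rewrite (integral_pushforward mY)// (integral_pushforward mX)// !preimage_setT.
Qed.

End spherical_symmetry.

(** * The Stein identity *)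

Lemma lipschitz_of_derive (R : realType) (f f' : R -> R) (L : R) :
  (forall x : R, is_derive x 1 f (f' x)) -> (forall x, `|f' x| <= L) ->
  forall x y, `|f x - f y| <= L * `|x - y|.
Proof.
move=> df f'L x y.
wlog yx : x y / y <= x.
  by move=> wl; have [/wl//|/ltW/wl] := leP y x; rewrite distrC (distrC x).
have [|c _ ->] := MVT_segment yx (fun z _ => df z).
  apply: continuous_subspaceT => z; apply: differentiable_continuous.
  by apply/derivable1_diffP; have [] := df z.
by rewrite normrM ler_wpM2r.
Qed.

Section rotation_parameter.
Context {R : realType}.
Implicit Types a : R.

(** The rational parametrisation of the circle: [rot_cos a] and [rot_sin a] are
    the cosine and sine of the rotation whose half angle has tangent [a]. *)
Definition rot_cos a := (1 - a ^+ 2) / (1 + a ^+ 2).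
Definition rot_sin a := 2 * a / (1 + a ^+ 2).

Let oneDsqr_gt0 a : 0 < 1 + a ^+ 2.
Proof. by rewrite ltr_pwDl// sqr_ge0. Qed.

Lemma rot_cos0 : rot_cos 0 = 1.
Proof. by rewrite /rot_cos expr0n/= subr0 addr0 divr1. Qed.

Lemma rot_sin0 : rot_sin 0 = 0.
Proof. by rewrite /rot_sin mulr0 mul0r. Qed.

Lemma rot_sin_gt0 a : 0 < a -> 0 < rot_sin a.
Proof. by move=> a0; rewrite divr_gt0// mulr_gt0. Qed.

Lemma rot_sin_le1 a : rot_sin a <= 1.
Proof. by rewrite ler_pdivrMr// mul1r; have := sqr_ge0 (1 - a); nra. Qed.

Lemma norm_rot_cos a : `|rot_cos a| <= 1.
Proof.
rewrite ler_norml ler_pdivlMr// ler_pdivrMr//; have := sqr_ge0 a.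
by move=> ?; apply/andP; split; lra.
Qed.

Lemma rot_cosE a : rot_cos a = 1 - a * rot_sin a.
Proof. by rewrite /rot_cos /rot_sin; field; rewrite gt_eqF. Qed.

Let oneDsqrV_cvg : (1 + a ^+ 2)^-1 @[a --> (0 : R)] --> (1 : R).
Proof.
rewrite -[X in _ --> X]invr1; apply: cvgV => //.
rewrite -[X in _ --> X](_ : 1 + 0 ^+ 2 = _); last by rewrite expr0n addr0.
by apply: cvgD; [exact: cvg_cst|exact: exprn_continuous].
Qed.

Lemma cvg_rot_sin : rot_sin a @[a --> (0 : R)] --> (0 : R).
Proof.
rewrite -[X in _ --> X](_ : 2 * 0 * 1 = _); last by rewrite mulr0 mul0r.
apply: cvgM; last exact: oneDsqrV_cvg.
by apply: cvgM; [exact: cvg_cst|exact: cvg_id].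
Qed.

Lemma cvg_rot_cos : rot_cos a @[a --> (0 : R)] --> (1 : R).
Proof.
rewrite -[X in _ --> X](_ : 1 - 0 * 0 = _); last by rewrite mulr0 subr0.
under eq_fun do rewrite rot_cosE.
apply: cvgB; first exact: cvg_cst.
by apply: cvgM; [exact: cvg_id|exact: cvg_rot_sin].
Qed.

End rotation_parameter.

Section stein_quotient.
Context {R : realType}.
Variables (f f' : R -> R) (L : R).
Hypothesis df : forall x : R, is_derive x 1 f (f' x).
Hypothesis f'L : forall x, `|f' x| <= L.

(** Up to sign, the difference quotient at angle 0 of the rotated function
    [z * f x] of the plane, without the term [z * f x * (1 - cos) / sin].  That
    term has mean 0 when [x] and [z] are coordinates of a spherically symmetric
    vector; what remains only involves the difference quotient of [f]. *)
Definition stein_quotient (a x z : R) :=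
  let y := rot_cos a * x + rot_sin a * z in
  x * f y - rot_cos a * z * ((f y - f x) / rot_sin a).

Let L_ge0 : 0 <= L. Proof. exact: le_trans (f'L 0). Qed.

Let rot_fstB (a x z : R) :
  rot_cos a * x + rot_sin a * z - x = rot_sin a * (z - a * x).
Proof. by rewrite rot_cosE; ring. Qed.

(** The Lipschitz bound on [f] controls both the growth of [f] and its difference
    quotient; square integrability of the coordinates then gives a dominating
    function uniform in [a]. *)
Lemma stein_quotient_le (a x z : R) : 0 < a <= 1 ->
  `|stein_quotient a x z| <= (`|f 0| + 3 * L) * (1 + x ^+ 2 + z ^+ 2).
Proof.
move=> /andP[a0 a1]; rewrite /stein_quotient.
set y := _ + rot_sin a * z.
have s0 := rot_sin_gt0 a0; have s1 := rot_sin_le1 a; have c1 := norm_rot_cos a.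
have lip := lipschitz_of_derive df f'L.
have x0 := normr_ge0 x; have z0 := normr_ge0 z.
have yxz : `|y| <= `|x| + `|z|.
  rewrite (le_trans (ler_normD _ _))// (normrM (rot_cos a)).
  by rewrite (normrM (rot_sin a)) (gtr0_norm s0) lerD// ler_piMl// ltW.
have fy : `|f y| <= `|f 0| + L * (`|x| + `|z|).
  rewrite -[f y](subrK (f 0)) addrC (le_trans (ler_normD _ _))// lerD2l.
  by rewrite (le_trans (lip _ _))// subr0 ler_wpM2l.
have q : `|(f y - f x) / rot_sin a| <= L * (`|x| + `|z|).
  rewrite normrM normfV (gtr0_norm s0) ler_pdivrMr//.
  rewrite (le_trans (lip _ _))// rot_fstB (normrM (rot_sin a)) (gtr0_norm s0).
  rewrite -[leRHS]mulrA ler_wpM2l// [leRHS]mulrC ler_wpM2l ?(ltW s0)//.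
  rewrite (le_trans (ler_normB _ _))// addrC lerD// normrM (gtr0_norm a0).
  by rewrite ler_piMl.
have h1 : `|x * f y| <= `|x| * (`|f 0| + L * (`|x| + `|z|)).
  by rewrite normrM ler_wpM2l.
have h2 : `|rot_cos a * z * ((f y - f x) / rot_sin a)| <=
    `|z| * (L * (`|x| + `|z|)).
  by rewrite normrM ler_pM// normrM ler_piMl.
rewrite (le_trans (ler_normB _ _))// (le_trans (lerD h1 h2))//.
rewrite -(real_normK (num_real x)) -(real_normK (num_real z)).
move: (`|x|) (`|z|) x0 z0 (normr_ge0 (f 0)) => u v u0 v0 f00.
have -> : u * (`|f 0| + L * (u + v)) + v * (L * (u + v)) =
  `|f 0| * u + L * (u + v) ^+ 2 by ring.
rewrite mulrDl lerD//.
  by rewrite ler_wpM2l//; have := sqr_ge0 (1 - u); have := sqr_ge0 v; nra.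
rewrite [3 * L]mulrC -[leRHS]mulrA ler_wpM2l//.
by have := sqr_ge0 (u - v); have := sqr_ge0 v; have := sqr_ge0 u; nra.
Qed.

Lemma cvg_stein_quotient (x z : R) :
  stein_quotient a x z @[a --> 0^'+] --> x * f x - z ^+ 2 * f' x.
Proof.
(* [g] is the slope of [f] at [x], extended by [f' x]: no division by a
   possibly zero increment. *)
have [g [fE cg gx]] := (is_derive1_caratheodory f x (f' x)).1 (df x).
pose y a := rot_cos a * x + rot_sin a * z.
have cy : y a @[a --> (0 : R)] --> x.
  rewrite -[X in _ --> X](_ : 1 * x + 0 * z = _); last by rewrite mul1r mul0r addr0.
  apply: cvgD; apply: cvgM.
  - exact: cvg_rot_cos.
  - exact: cvg_cst.
  - exact: cvg_rot_sin.
  - exact: cvg_cst.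
have cf : {for x, continuous f}.
  by apply: differentiable_continuous; apply/derivable1_diffP; have [] := df x.
pose q a := x * f (y a) - rot_cos a * z * (g (y a) * (z - a * x)).
have cq : q a @[a --> (0 : R)] --> x * f x - z ^+ 2 * f' x.
  rewrite -[X in _ --> X](_ : x * f x - 1 * z * (g x * (z - 0 * x)) = _); last first.
    by rewrite gx; ring.
  apply: cvgB.
    apply: cvgM; first exact: cvg_cst.
    exact: (cvg_comp _ _ cy cf).
  apply: cvgM.
    by apply: cvgM; [exact: cvg_rot_cos|exact: cvg_cst].
  apply: cvgM; first exact: (cvg_comp _ _ cy cg).
  apply: cvgB; first exact: cvg_cst.
  by apply: cvgM; [exact: cvg_id|exact: cvg_cst].
apply: (@cvg_trans _ (q a @[a --> 0^'+])); last exact: cvg_at_right_filter.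
apply: near_eq_cvg; near=> a.
rewrite /q /stein_quotient -/(y a) fE /y rot_fstB.
have s0 : rot_sin a != 0 by rewrite gt_eqF// rot_sin_gt0.
by field.
Unshelve. all: by end_near. Qed.

End stein_quotient.

Section stein_identity.
Context d (T : measurableType d) (R : realType) (P : probability T R) (n : nat).
Variable X : {RV P >-> n.-tuple R}.
Hypothesis hsph : spherically_symmetric X.
Variables (i k : 'I_n) (ik : i != k).
Hypothesis iX2 : forall j,
  P.-integrable setT (EFin \o (fun w => rvcoord X j w ^+ 2)).
Variables (f f' : R -> R) (L : R).
Hypothesis df : forall x : R, is_derive x 1 f (f' x).
Hypothesis cf' : continuous f'.
Hypothesis f'L : forall x, `|f' x| <= L.

Let measurable_coord j : measurable_fun setT (rvcoord X j).
Proof. exact: (measurableT_comp (measurable_tnth j)). Qed.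

Let cf : continuous f.
Proof.
move=> x; apply: differentiable_continuous; apply/derivable1_diffP.
by have [] := df x.
Qed.

Let mf : measurable_fun setT f.
Proof. exact: continuous_measurable_fun. Qed.

Let mf' : measurable_fun setT f'.
Proof. exact: continuous_measurable_fun. Qed.

Let dom w := (`|f 0| + 3 * L) * (1 + rvcoord X i w ^+ 2 + rvcoord X k w ^+ 2).

Let integrable_dom : P.-integrable setT (EFin \o dom).
Proof.
apply: integrable_mulrl => //; apply: integrable_addr => //.
by apply: integrable_addr => //; exact: finite_measure_integrable_cst.
Qed.

Let phi (x : n.-tuple R) := tnth x k * f (tnth x i).

Let mphi : measurable_fun setT phi.
Proof.
apply: measurable_funM; first exact: measurable_tnth.
by apply: measurableT_comp => //; exact: measurable_tnth.
Qed.

Let L_ge0 : 0 <= L. Proof. exact: le_trans (f'L 0). Qed.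

Let integrable_phi : P.-integrable setT (EFin \o (phi \o X)).
Proof.
apply: integrable_ler integrable_dom _ _ => //.
  exact: measurableT_comp.
move=> w _; rewrite /phi /dom /rvcoord/= normrM.
set x := tnth (X w) i; set z := tnth (X w) k.
have fx : `|f x| <= `|f 0| + L * `|x|.
  rewrite -[f x](subrK (f 0)) addrC (le_trans (ler_normD _ _))// lerD2l.
  by rewrite (le_trans (lipschitz_of_derive df f'L _ _))// subr0.
rewrite (le_trans (ler_wpM2l (normr_ge0 z) fx))//.
rewrite -(real_normK (num_real x)) -(real_normK (num_real z)).
move: (`|x|) (`|z|) (normr_ge0 x) (normr_ge0 z) (normr_ge0 (f 0)).
move=> u v u0 v0 f00; rewrite mulrDr mulrDl lerD//.
  rewrite mulrC ler_wpM2l//.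
  by have := sqr_ge0 (1 - v); have := sqr_ge0 u; nra.
rewrite mulrCA [3 * L]mulrC -[leRHS]mulrA ler_wpM2l//.
by have := sqr_ge0 (u - v); have := sqr_ge0 v; have := sqr_ge0 u; nra.
Qed.

Let reflect_phi a :
  P.-integrable setT (EFin \o (phi \o mulmt (axis_reflection a i k) \o X)) /\
  \int[P]_w phi (mulmt (axis_reflection a i k) (X w)) = \int[P]_w phi (X w).
Proof. by apply: spherical_Rintegral => //; exact: orthogonal_householder. Qed.

(** For [a = 0] the reflection changes the sign of the coordinate [k]. *)
Let Ephi0 : \int[P]_w phi (X w) = 0.
Proof.
have [_] := reflect_phi 0.
under eq_Rintegral => w _.
  rewrite /phi axis_reflection_fst// axis_reflection_snd//.
  rewrite -/(rot_cos 0) -/(rot_sin 0) rot_cos0 rot_sin0 !mul0r !mul1r addr0 sub0r.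
  rewrite mulNr -mulN1r -/(phi (X w)).
  over.
by rewrite RintegralZl//; lra.
Qed.

Let q a w := stein_quotient f a (rvcoord X i w) (rvcoord X k w).

(** [q a * rot_sin a] is the sum of [phi], evaluated at the reflected vector, and
    a multiple of [phi X]; both have mean 0. *)
Let Eq0 a : 0 < a -> \int[P]_w q a w = 0.
Proof.
move=> a0; have s0 : rot_sin a != 0 by rewrite gt_eqF// rot_sin_gt0.
have [ir Er] := reflect_phi a.
transitivity (\int[P]_w ((rot_sin a)^-1 *
    (phi (mulmt (axis_reflection a i k) (X w)) + rot_cos a * phi (X w)))).
  apply: eq_Rintegral => w _.
  rewrite /phi axis_reflection_fst// axis_reflection_snd//.
  by rewrite -/(rot_cos a) -/(rot_sin a) /q /stein_quotient /rvcoord; field.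
have ic : P.-integrable setT (EFin \o (fun w => rot_cos a * phi (X w))).
  exact: integrable_mulrl.
rewrite RintegralZl//; last exact: integrable_addr.
by rewrite RintegralD// RintegralZl// Er Ephi0 mulr0 addr0 mulr0.
Qed.

Let measurable_q a : measurable_fun setT (q a).
Proof.
have my : measurable_fun setT
    (fun w => rot_cos a * rvcoord X i w + rot_sin a * rvcoord X k w).
  by apply: measurable_funD; apply: measurable_funM.
apply: measurable_funB.
  by apply: measurable_funM => //; exact: measurableT_comp.
apply: measurable_funM; first exact: measurable_funM.
apply: measurable_funM => //; apply: measurable_funB; exact: measurableT_comp.
Qed.

(** [stein_quotient f a] has mean 0 for every positive [a], and converges to
    [x * f x - z ^+ 2 * f' x] under domination as [a] tends to 0. *)
Lemma stein_identity :
  P.-integrable setT (EFin \o (fun w => rvcoord X i w * f (rvcoord X i w))) /\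
  \int[P]_w (rvcoord X i w * f (rvcoord X i w)) =
  \int[P]_w (rvcoord X k w ^+ 2 * f' (rvcoord X i w)).
Proof.
set xf := fun w => rvcoord X i w * f (rvcoord X i w).
set zf := fun w => rvcoord X k w ^+ 2 * f' (rvcoord X i w).
have mxf : measurable_fun setT xf.
  by apply: measurable_funM => //; exact: measurableT_comp.
have mzf : measurable_fun setT zf.
  by apply: measurable_funM; [exact: measurable_funX|exact: measurableT_comp].
have izf : P.-integrable setT (EFin \o zf).
  apply: integrable_ler (integrable_mulrl measurableT L (iX2 k)) mzf _ => //.
  move=> w _; rewrite /zf normrM mulrC (ger0_norm (sqr_ge0 _)).
  by rewrite ler_wpM2r// sqr_ge0.
have h01 m : 0 < (harmonic m : R) <= 1.
  by rewrite harmonic_gt0 /harmonic/= invf_le1 ?ltr0n// ler1n.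
have [|||||ilim _ Elim] := @dominated_convergence _ _ _ P setT measurableT
  (fun m w => (q (harmonic m) w)%:E) (EFin \o (fun w => xf w - zf w))
  (EFin \o dom).
- by move=> m; exact/measurable_EFinP.
- by apply/measurable_EFinP; exact: measurable_funB.
- apply: aeW => w _; apply/fine_cvgP; split; first exact: nearW.
  have /cvg_at_rightP :=
    @cvg_stein_quotient _ _ _ df (rvcoord X i w) (rvcoord X k w).
  by apply; split; [move=> m; exact: harmonic_gt0|exact: cvg_harmonic].
- exact: integrable_dom.
- apply: aeW => w m _; rewrite lee_fin; exact: stein_quotient_le.
have ixf : P.-integrable setT (EFin \o xf).
  have := integrable_addr measurableT ilim izf.
  by apply: eq_integrable => // w _ /=; rewrite subrK.
split => //; apply/eqP; rewrite -subr_eq0 -RintegralB//.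
have q0 m : (\int[P]_w (q (harmonic m) w)%:E)%E = 0%E.
  rewrite -EFin_Rintegral ?Eq0 ?harmonic_gt0//.
  apply: integrable_ler integrable_dom (measurable_q _) _ => // w _.
  exact: stein_quotient_le.
move: Elim; under eq_fun do rewrite q0.
move=> /(cvg_lim (@ereal_hausdorff R)); rewrite lim_cst; last exact: ereal_hausdorff.
by rewrite /Rintegral => <-.
Qed.

End stein_identity.

(** * Testing a conditional expectation against bounded functions *)

Section conditional_expectation.
Context d (T : measurableType d) (R : realType) (P : probability T R).
Variables (Y Z g : T -> R).
Hypotheses (iY : P.-integrable setT (EFin \o Y)) (mZ : measurable_fun setT Z).
Hypothesis gE : is_cond_exp P Y Z g.

(** The difference of the two sides vanishes on indicators by definition of the
    conditional expectation, and is bounded by the mean of [`|Y - g|]. *)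
Lemma cond_exp_Rintegral_bounded M (psi : R -> R) : measurable_fun setT psi ->
  (forall x, `|psi x| <= M) ->
  \int[P]_w (psi (Z w) * Y w) = \int[P]_w (psi (Z w) * g w).
Proof.
move=> mpsi psiM; have [_ ig gA] := gE.
have iYg : P.-integrable setT (EFin \o (fun w => Y w - g w)).
  exact: integrable_subr.
have ipsi M' (u : R -> R) (V : T -> R) : P.-integrable setT (EFin \o V) ->
    measurable_fun setT u -> (forall x, `|u x| <= M') ->
    P.-integrable setT (EFin \o (fun w => u (Z w) * V w)).
  move=> iV mu uM.
  apply: (@integrable_ler _ _ _ _ _ measurableT (fun w => M' * `|V w|)).
  - by apply: integrable_mulrl => //; exact: integrable_norm iV.
  - apply: measurable_funM; first exact: measurableT_comp.
    exact/measurable_EFinP/(measurable_int P).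
  - by move=> w _; rewrite normrM ler_wpM2r.
apply/eqP; rewrite -subr_eq0 -RintegralB//; last 2 first.
  exact: ipsi psiM.
  exact: ipsi psiM.
under eq_Rintegral do rewrite -mulrBr.
apply/eqP; apply: (@bounded_functional_eq0 _ _ _
  (fun u => \int[P]_w (u (Z w) * (Y w - g w))) (\int[P]_w `|Y w - g w|)
  _ _ psi M) => //.
- move=> u M' a A mu uM' mA.
  have m1 : measurable_fun setT (\1_A : R -> R) by [].
  have b1 := @normr_indic_le1 _ R A.
  have i1 := ipsi _ _ _ iYg m1 b1.
  under eq_Rintegral do rewrite mulrDl -mulrA.
  rewrite RintegralD//; last 2 first.
    exact: ipsi uM'.
    exact: integrable_mulrl.
  rewrite RintegralZl// [X in _ + _ * X](_ : _ = 0) ?mulr0 ?addr0//.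
  have mZA : measurable (Z @^-1` A) by rewrite -[X in measurable X]setTI; exact: mZ.
  transitivity (\int[P]_(w in Z @^-1` A) (Y w - g w)).
    rewrite [RHS]Rintegral_mkcond; apply: eq_Rintegral => w _.
    rewrite patchE indicE (_ : (Z w \in A) = (w \in Z @^-1` A)).
      by case: ifP; rewrite ?mul1r ?mul0r.
    by apply/idP/idP; rewrite !inE.
  rewrite RintegralB//; [|exact: integrableS iY|exact: integrableS ig].
  rewrite /Rintegral gA ?subrr//.
  by exists A => //; rewrite setTI.
- move=> u M' mu uM'; have iu := ipsi _ _ _ iYg mu uM'.
  have iN := integrable_norm iYg.
  rewrite (le_trans (le_normr_Rintegral measurableT iu))// mulrC -RintegralZl//.
  apply: le_Rintegral => //; first exact: integrable_norm iu.
    exact: integrable_mulrl.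
  by move=> w _; rewrite normrM ler_wpM2r.
Qed.

End conditional_expectation.

(** * Bounds for isotropic spherically symmetric vectors *)

Section spherical_isotropic.
Context d (T : measurableType d) (R : realType) (P : probability T R) (n : nat).
Variable X : {RV P >-> n.-tuple R}.
Hypotheses (hiso : isotropic X) (hsph : spherically_symmetric X).
Variables (i k : 'I_n) (ik : i != k).
Local Notation Xc := (rvcoord X).

Lemma measurable_rvcoord j : measurable_fun setT (Xc j).
Proof. exact: (measurableT_comp (measurable_tnth j)). Qed.

Let measurable_rvcoord_sqr j : measurable_fun setT (fun w => Xc j w ^+ 2).
Proof. by apply: measurable_funX; exact: measurable_rvcoord. Qed.

Let integral_rvcoord_sqr j : (\int[P]_w (Xc j w ^+ 2)%:E = 1)%E.
Proof.
have := hiso.2 j j; rewrite eqxx unlock => <-.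
by apply: eq_integral => w _; rewrite expr2.
Qed.

Lemma integrable_rvcoord_sqr j :
  P.-integrable setT (EFin \o (fun w => Xc j w ^+ 2)).
Proof.
apply/integrableP; split; first exact/measurable_EFinP.
under eq_integral do rewrite /= ger0_norm ?sqr_ge0//.
by rewrite integral_rvcoord_sqr ltry.
Qed.

Lemma Rintegral_rvcoord_sqr j : \int[P]_w (Xc j w ^+ 2) = 1.
Proof. by rewrite /Rintegral integral_rvcoord_sqr. Qed.

Lemma norm2_sqrE w : norm2 (X w) ^+ 2 = \sum_(j < n) Xc j w ^+ 2.
Proof.
rewrite /norm2 sqr_sqrtr; last by apply: sumr_ge0 => j _; rewrite -expr2 sqr_ge0.
by apply: eq_bigr => j _; rewrite -expr2.
Qed.

Let integrable_sum_sqr (s : seq 'I_n) (p : pred 'I_n) :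
  P.-integrable setT (EFin \o (fun w => \sum_(j <- s | p j) Xc j w ^+ 2)).
Proof.
have := @integrable_sum _ _ _ P setT measurableT _ s p
  (fun j w => (Xc j w ^+ 2)%:E) (fun j _ => integrable_rvcoord_sqr j).
by apply: eq_integrable => // w _ /=; rewrite sumEFin.
Qed.

Lemma integrable_norm2_sqr :
  P.-integrable setT (EFin \o (fun w => norm2 (X w) ^+ 2)).
Proof.
apply: eq_integrable (integrable_sum_sqr (index_enum 'I_n) xpredT) => //.
by move=> w _ /=; rewrite norm2_sqrE.
Qed.

Let Rintegral_sum (s : seq 'I_n) (p : pred 'I_n) (F : 'I_n -> T -> R) :
  (forall j, P.-integrable setT (EFin \o F j)) ->
  \int[P]_w (\sum_(j <- s | p j) F j w) = \sum_(j <- s | p j) \int[P]_w F j w.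
Proof.
move=> iF; rewrite /Rintegral.
under eq_integral do rewrite -sumEFin.
rewrite integral_sum//.
by under eq_bigr do rewrite -EFin_Rintegral//; rewrite sumEFin.
Qed.

Lemma Rintegral_norm2_sqr : \int[P]_w (norm2 (X w) ^+ 2) = n%:R.
Proof.
under eq_Rintegral do rewrite norm2_sqrE.
rewrite Rintegral_sum; last exact: integrable_rvcoord_sqr.
under eq_bigr do rewrite Rintegral_rvcoord_sqr.
by rewrite sumr_const card_ord.
Qed.

Let integrable_bounded_sqr M (psi : R -> R) (j : 'I_n) :
  measurable_fun setT psi -> (forall x, `|psi x| <= M) ->
  P.-integrable setT (EFin \o (fun w => psi (Xc i w) * Xc j w ^+ 2)).
Proof.
move=> mpsi psiM.
apply: (@integrable_ler _ _ _ _ _ measurableT (fun w => M * Xc j w ^+ 2)).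
- by apply: integrable_mulrl => //; exact: integrable_rvcoord_sqr.
- by apply: measurable_funM => //; apply: measurableT_comp => //;
    exact: measurable_rvcoord.
- by move=> w _; rewrite normrM [X in _ * X]ger0_norm ?sqr_ge0// ler_wpM2r ?sqr_ge0.
Qed.

(** The reflection that exchanges the axes [j] and [k] fixes the axis [i]. *)
Lemma spherical_exchange M (psi : R -> R) j : measurable_fun setT psi ->
  (forall x, `|psi x| <= M) -> j != i ->
  \int[P]_w (psi (Xc i w) * Xc j w ^+ 2) = \int[P]_w (psi (Xc i w) * Xc k w ^+ 2).
Proof.
move=> mpsi psiM ji; have [->//|jk] := eqVneq j k.
pose phi (x : n.-tuple R) := psi (tnth x i) * tnth x k ^+ 2.
have mphi : measurable_fun setT phi.
  apply: measurable_funM; last by apply: measurable_funX; exact: measurable_tnth.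
  by apply: measurableT_comp => //; exact: measurable_tnth.
have [_ <-] := spherical_Rintegral hsph
  (orthogonal_householder (axis_vect 1 j k)) mphi
  (integrable_bounded_sqr k mpsi psiM).
apply: eq_Rintegral => w _; rewrite /phi -/(axis_reflection 1 j k).
have -> : tnth (mulmt (axis_reflection 1 j k) (X w)) i = tnth (X w) i.
  by rewrite tnth_axis_reflection// eq_sym (negbTE ji) (negbTE ik) !(mulr0, subr0).
have -> // : tnth (mulmt (axis_reflection 1 j k) (X w)) k = tnth (X w) j.
by rewrite axis_reflection_snd// expr1n subrr !mul0r subr0 mulr1 divff// mul1r.
Qed.

Variable g : T -> R.
Hypothesis gE : is_cond_exp P (fun w => Xc k w ^+ 2) (Xc i) g.

Let ig : P.-integrable setT (EFin \o g). Proof. by case: gE. Qed.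

Lemma integrable_norm1B : P.-integrable setT (EFin \o (fun w => `|1 - g w|)).
Proof.
have i1 : P.-integrable setT (EFin \o cst 1) by exact: finite_measure_integrable_cst.
by have := integrable_norm (integrable_subr measurableT i1 ig).
Qed.

(** By the Stein equation and the Stein identity the left side is the mean of
    [f' * (1 - X_k ^+ 2)], and conditioning replaces [X_k ^+ 2] by [g]. *)
Lemma stein_bound (h : R -> R) : continuous h -> (forall x, 0 <= h x <= 1) ->
  `|\int[P]_w h (Xc i w) - \int[normal_prob 0 1]_x h x| <=
  2 * \int[P]_w `|1 - g w|.
Proof.
move=> ch h01; have [f [f' [df cf' f'2 fE]]] := stein_solution ch h01.
have [ixf xfE] := stein_identity hsph ik integrable_rvcoord_sqr df cf' f'2.
have mf' : measurable_fun setT f' by exact: continuous_measurable_fun.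
have mh : measurable_fun setT h by exact: continuous_measurable_fun.
have mf'i : measurable_fun setT (fun w => f' (Xc i w)).
  by apply: measurableT_comp => //; exact: measurable_rvcoord.
have if' : P.-integrable setT (EFin \o (fun w => f' (Xc i w))).
  by apply: integrable_boundedr mf'i _ => w; exact: f'2.
have ih : P.-integrable setT (EFin \o (fun w => h (Xc i w))).
  apply: (@integrable_boundedr _ _ _ _ 1).
    by apply: measurableT_comp => //; exact: measurable_rvcoord.
  by move=> w; have /andP[h0 h1] := h01 (Xc i w); rewrite ger0_norm.
set p := \int[normal_prob 0 1]_x h x in fE *.
have ip : P.-integrable setT (EFin \o cst p) by exact: finite_measure_integrable_cst.
have igf : P.-integrable setT (EFin \o (fun w => f' (Xc i w) * g w)).
  apply: (@integrable_ler _ _ _ _ _ measurableT (fun w => 2 * `|g w|)).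
  - by apply: integrable_mulrl => //; exact: integrable_norm ig.
  - by apply: measurable_funM => //; exact/measurable_EFinP/(measurable_int P).
  - by move=> w _; rewrite normrM ler_wpM2r.
have -> : \int[P]_w h (Xc i w) - p = \int[P]_w (f' (Xc i w) * (1 - g w)).
  rewrite -[X in _ - X](Rintegral_cst_prob P) -RintegralB//.
  transitivity (\int[P]_w (f' (Xc i w) - Xc i w * f (Xc i w))).
    by apply: eq_Rintegral => w _; rewrite fE.
  rewrite RintegralB// xfE.
  under [X in _ - X]eq_Rintegral do rewrite mulrC.
  rewrite (cond_exp_Rintegral_bounded (integrable_rvcoord_sqr k)
    (measurable_rvcoord i) gE mf' f'2).
  rewrite -RintegralB//; apply: eq_Rintegral => w _.
  by rewrite mulrBr mulr1.
have i1g : P.-integrable setT (EFin \o (fun w => f' (Xc i w) * (1 - g w))).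
  apply: eq_integrable (integrable_subr measurableT if' igf) => //.
  by move=> w _ /=; rewrite mulrBr mulr1.
rewrite (le_trans (le_normr_Rintegral measurableT i1g))//.
rewrite -RintegralZl//; last exact: integrable_norm1B.
apply: le_Rintegral => //.
- exact: integrable_norm i1g.
- by apply: integrable_mulrl => //; exact: integrable_norm1B.
- by move=> w _; rewrite normrM ler_wpM2r.
Qed.

(** The sign [psi] of [g - 1] is a function of [X_i], so it may be tested against
    [X_k ^+ 2] instead of [g], and by exchangeability against each other
    coordinate; summing over them makes the norm of [X] appear. *)
Lemma cond_exp_norm_bound : (1 < n)%N ->
  \int[P]_w `|1 - g w| <=
  (\int[P]_w `|norm2 (X w) ^+ 2 - n%:R| + 2) / (n%:R - 1).
Proof.
move=> n1; have [mg _ _] := gE.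
have c0 : 0 < n%:R - 1 :> R by rewrite subr_gt0 ltr1n.
have [B mB gB] : exists2 B, measurable B & forall w, (Xc i w \in B) = (1 <= g w).
  have [|B mB] := mg measurableT `[1, +oo[%classic; first exact: measurable_itv.
  rewrite !setTI => BE; exists B => // w.
  have <- : (w \in Xc i @^-1` B) = (Xc i w \in B).
    by apply/idP/idP; rewrite !inE.
  by rewrite BE; apply/idP/idP; rewrite inE/= in_itv/= andbT.
(* [g] is measurable for the sigma-algebra of [X_i], hence so is the set where
   it is at least 1: it is the inverse image of [B]. *)
pose psi (x : R) : R := \1_B x - \1_(~` B) x.
have mpsi : measurable_fun setT psi.
  by apply: measurable_funB; apply: measurable_indic => //; exact: measurableC.
have psiE x : psi x = if x \in B then 1 else -1.
  by rewrite /psi !indicE in_setC; case: (x \in B); rewrite /= ?subr0 ?sub0r.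
have psi1 x : `|psi x| <= 1 by rewrite psiE; case: ifP; rewrite ?normrN normr1.
have psiXg w : `|1 - g w| = psi (Xc i w) * (g w - 1).
  rewrite psiE gB; case: leP => gw.
    by rewrite mul1r ler0_norm ?opprB ?subr_le0.
  by rewrite mulN1r opprB gtr0_norm// subr_gt0.
have mpsiX : measurable_fun setT (fun w => psi (Xc i w)).
  by apply: measurableT_comp => //; exact: measurable_rvcoord.
have ipsi : P.-integrable setT (EFin \o (fun w => psi (Xc i w))).
  by apply: integrable_boundedr mpsiX _ => w; exact: psi1.
have ipsig : P.-integrable setT (EFin \o (fun w => psi (Xc i w) * g w)).
  apply: eq_integrable (integrable_addr measurableT integrable_norm1B ipsi) => //.
  by move=> w _ /=; rewrite psiXg; congr EFin; ring.
have ipsij j := integrable_bounded_sqr j mpsi psi1.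
have iN : P.-integrable setT (EFin \o (fun w => norm2 (X w) ^+ 2 - n%:R)).
  apply: integrable_subr => //; first exact: integrable_norm2_sqr.
  exact: finite_measure_integrable_cst.
have iX1 : P.-integrable setT (EFin \o (fun w => Xc i w ^+ 2 + 1)).
  apply: integrable_addr => //; first exact: integrable_rvcoord_sqr.
  exact: finite_measure_integrable_cst.
have Esum : \int[P]_w (psi (Xc i w) * \sum_(j < n | j != i) Xc j w ^+ 2) =
    (n%:R - 1) * \int[P]_w (psi (Xc i w) * Xc k w ^+ 2).
  under eq_Rintegral do rewrite mulr_sumr.
  rewrite Rintegral_sum//.
  under eq_bigr => j ji do rewrite (spherical_exchange mpsi psi1 ji).
  rewrite sumr_const cardC1 card_ord -[LHS]mulr_natl -subn1 natrB//.
  exact: ltnW.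
have isum : P.-integrable setT
    (EFin \o (fun w => psi (Xc i w) * \sum_(j < n | j != i) Xc j w ^+ 2)).
  have := @integrable_sum _ _ _ P setT measurableT _ (index_enum 'I_n)
    (fun j => j != i) (fun j w => (psi (Xc i w) * Xc j w ^+ 2)%:E)
    (fun j _ => ipsij j).
  by apply: eq_integrable => // w _ /=; rewrite sumEFin mulr_sumr.
have normE w :
    norm2 (X w) ^+ 2 = Xc i w ^+ 2 + \sum_(j < n | j != i) Xc j w ^+ 2.
  by rewrite norm2_sqrE (bigD1 i).
have key : (n%:R - 1) * \int[P]_w `|1 - g w| =
    \int[P]_w (psi (Xc i w) * ((norm2 (X w) ^+ 2 - n%:R) - (Xc i w ^+ 2 - 1))).
  under eq_Rintegral do rewrite psiXg mulrBr mulr1.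
  rewrite RintegralB// -(cond_exp_Rintegral_bounded (integrable_rvcoord_sqr k)
    (measurable_rvcoord i) gE mpsi psi1).
  rewrite mulrBr -Esum -RintegralZl// -RintegralB//; last exact: integrable_mulrl.
  apply: eq_Rintegral => w _; rewrite normE; ring.
have idiff : P.-integrable setT (EFin \o (fun w => psi (Xc i w) *
    ((norm2 (X w) ^+ 2 - n%:R) - (Xc i w ^+ 2 - 1)))).
  have := integrable_subr measurableT isum
    (integrable_mulrl measurableT (n%:R - 1) ipsi).
  apply: eq_integrable => // w _ /=; congr EFin.
  by rewrite normE; ring.
rewrite ler_pdivlMr// mulrC key.
apply: le_trans (ler_norm _) _; apply: le_trans (le_normr_Rintegral _ idiff) _ => //.
have -> : 2 = \int[P]_w (Xc i w ^+ 2 + 1).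
  rewrite RintegralD//; last 2 first.
    exact: integrable_rvcoord_sqr.
    exact: finite_measure_integrable_cst.
  by rewrite Rintegral_rvcoord_sqr (Rintegral_cst_prob P).
rewrite -RintegralD//; last exact: integrable_norm iN.
apply: le_Rintegral => //.
- exact: integrable_norm idiff.
- by apply: integrable_addr => //; exact: integrable_norm iN.
- move=> w _; rewrite normrM.
  apply: le_trans (ler_piMl _ (psi1 _)) _ => //.
  apply: le_trans (ler_normB _ _) _; rewrite lerD2l.
  apply: le_trans (ler_normB _ _) _.
  by rewrite normr1 ger0_norm ?sqr_ge0.
Qed.

End spherical_isotropic.

Lemma expectation_EFin d (T : measurableType d) (R : realType)
    (P : probability T R) (Y : T -> R) : P.-integrable setT (EFin \o Y) ->
  ('E_P[Y] = (\int[P]_w Y w)%:E)%E.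
Proof. by move=> iY; rewrite unlock EFin_Rintegral. Qed.

(** Cauchy-Schwarz, from the nonnegative mean of the square of [`|Y - m| - a],
    with [a] the mean deviation; an infinite variance makes it trivial. *)
Lemma mean_deviation_le_sd d (T : measurableType d) (R : realType)
    (P : probability T R) (Y : T -> R) (m : R) :
  P.-integrable setT (EFin \o Y) -> \int[P]_w Y w = m ->
  ((\int[P]_w `|Y w - m|)%:E <= sqrte 'V_P[Y])%E.
Proof.
move=> iY EY.
have VE : 'V_P[Y] = (\int[P]_w ((Y w - m) ^+ 2)%:E)%E.
  rewrite /variance covariance.unlock (expectation_EFin iY) EY unlock.
  by apply: eq_integral => w _ /=; rewrite expr2.
have im : P.-integrable setT (EFin \o cst m) by exact: finite_measure_integrable_cst.
have iYm := integrable_subr measurableT iY im.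
have iN : P.-integrable setT (EFin \o (fun w => `|Y w - m|)).
  by have := integrable_norm iYm.
have mYm : measurable_fun setT (fun w => Y w - m).
  exact/measurable_EFinP/(measurable_int P).
have V0 := variance_ge0 P Y.
have [Vy|Vy] := eqVneq 'V_P[Y] +oo%E; first by rewrite Vy leey.
have iYm2 : P.-integrable setT (EFin \o (fun w => (Y w - m) ^+ 2)).
  apply/integrableP; split; first exact/measurable_EFinP/measurable_funX.
  under eq_integral do rewrite /= ger0_norm ?sqr_ge0//.
  by rewrite -VE ltey.
rewrite VE -EFin_Rintegral//= lee_fin.
set a := \int[P]_w `|Y w - m|.
have a0 : 0 <= a by apply: Rintegral_ge0.
rewrite -(ger0_norm a0) -sqrtr_sqr ler_sqrt; last first.
  by apply: Rintegral_ge0 => w _; exact: sqr_ge0.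
have ia : P.-integrable setT (EFin \o cst (a ^+ 2)).
  exact: finite_measure_integrable_cst.
have i2a : P.-integrable setT (EFin \o (fun w => 2 * a * `|Y w - m|)).
  exact: integrable_mulrl.
have : 0 <= \int[P]_w ((Y w - m) ^+ 2 - 2 * a * `|Y w - m| + a ^+ 2).
  apply: Rintegral_ge0 => w _; rewrite -(real_normK (num_real (Y w - m))).
  by have := sqr_ge0 (`|Y w - m| - a); rewrite sqrrB; lra.
rewrite RintegralD//; last exact: integrable_subr.
rewrite (Rintegral_cst_prob P (a ^+ 2)) RintegralB// RintegralZl// -/a.
by lra.
Qed.

Section total_variation.
Context d (T : measurableType d) (R : realType) (P : probability T R) (n : nat).
Variable X : {RV P >-> n.-tuple R}.
Hypotheses (hiso : isotropic X) (hsph : spherically_symmetric X).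

Lemma law_dot_coord theta (i : 'I_n) A : sphere theta -> measurable A ->
  law_dot X theta A = P (rvcoord X i @^-1` A).
Proof.
move=> htheta mA; have [Q Qo QE] := exists_orthogonal_fst i htheta.
have -> : law_dot X theta A =
    distribution P X (mulmt Q @^-1` ((fun x => tnth x i) @^-1` A)).
  congr (P _); apply/funext => w /=; congr A.
  by rewrite QE /dotr dotpC.
rewrite hsph//; rewrite -[X in measurable X]setTI.
exact: measurable_tnth.
Qed.

Lemma dTV_normal_le (i k : 'I_n) (g : T -> R) theta : i != k ->
  is_cond_exp P (fun w => rvcoord X k w ^+ 2) (rvcoord X i) g ->
  sphere theta ->
  (dTV (law_dot X theta) (normal_prob 0 1) <=
   (4 * \int[P]_w `|1 - g w|)%:E)%E.
Proof.
move=> ik gE htheta; set K := \int[P]_w _.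
have mXi : @measurable_fun _ _ T (measurableTypeR R) setT (rvcoord X i).
  exact: measurable_rvcoord.
pose Xi : {RV P >-> measurableTypeR R} := 
  @mfun_Sub _ _ T (measurableTypeR R) (rvcoord X i) (mem_set mXi).
rewrite /dTV (_ : 4 * K = 2 * (2 * K)); last by ring.
rewrite EFinM lee_pmul2l//; apply: ge_ereal_sup => _ [A mA <-].
rewrite (law_dot_coord i)//.
have finP : P (rvcoord X i @^-1` A) \is a fin_num.
  apply: fin_num_measure; rewrite -[X in measurable X]setTI.
  exact: measurable_rvcoord.
rewrite -(fineK finP) -[normal_prob 0 1 A]fineK ?fin_num_measure//.
rewrite -EFinB abse_EFin lee_fin.
have := @distance_le_continuous R (distribution P Xi) (normal_prob 0 1)
  (2 * K) _ A mA.
apply; move=> h ch h01.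
have mh : measurable_fun setT h by exact: continuous_measurable_fun.
rewrite [X in `|X - _|](_ : _ = \int[P]_w h (rvcoord X i w)).
  exact: (stein_bound hiso hsph ik gE ch h01).
rewrite /Rintegral integral_distribution//; first exact/measurable_EFinP.
apply: (@integrable_boundedr _ _ _ _ 1).
  by apply: measurableT_comp => //; exact: measurable_rvcoord.
by move=> w; have /andP[h0 h1] := h01 (rvcoord X i w); rewrite ger0_norm.
Qed.

End total_variation.

Theorem theorem7 (R : realType) (d : measure_display) (T : measurableType d)
    (P : probability T R) (n : nat) (hn : (1 < n)%N)
    (X : {RV P >-> n.-tuple R})
    (hiso : isotropic X) (h3 : finite_third_moment X)
    (hsph : spherically_symmetric X)
    (theta : n.-tuple R) (htheta : sphere theta) :
  let X1 := rvcoord X (Ordinal (ltnW hn)) in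
  let X2 := rvcoord X (Ordinal hn) in
  forall g : T -> R, is_cond_exp P (fun w => X2 w ^+ 2) X1 g ->
  let normX2 := fun w => norm2 (X w) ^+ 2 in
  let c : R := n%:R - 1 in
  [/\ (dTV (law_dot X theta) (normal_prob 0 1)
         <= 4%:E * 'E_P[fun w => `|1 - g w|%R])%E,
      (4%:E * 'E_P[fun w => `|1 - g w|%R]
         <= (4 / c)%:E * 'E_P[fun w => `|normX2 w - n%:R|%R] + (8 / c)%:E)%E &
      ((4 / c)%:E * 'E_P[fun w => `|normX2 w - n%:R|%R] + (8 / c)%:E
         <= (4 / c)%:E * sqrte 'V_P[normX2] + (8 / c)%:E)%E].
Proof.
move=> X1 X2 g gE normX2 c.
have ik : Ordinal (ltnW hn) != Ordinal hn by [].
have c0 : 0 < c by rewrite subr_gt0 ltr1n.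
have iN : P.-integrable setT (EFin \o normX2) by exact: integrable_norm2_sqr.
have iNn : P.-integrable setT (EFin \o (fun w => `|normX2 w - n%:R|)).
  have iB := integrable_subr measurableT iN
    (finite_measure_integrable_cst P n%:R measurableT).
  by have := integrable_norm iB.
rewrite !expectation_EFin//; last exact: integrable_norm1B gE.
split.
- by rewrite -EFinM; exact: dTV_normal_le gE htheta.
- rewrite -!EFinM -EFinD lee_fin.
  have := cond_exp_norm_bound hiso hsph ik gE hn; rewrite -/c -/normX2.
  set a := \int[P]_w _; set b := \int[P]_w _ => ab.
  have -> : 4 / c * b + 8 / c = 4 * ((b + 2) / c) by field; rewrite gt_eqF.
  by rewrite ler_wpM2l.
- apply: leeD2r; apply: lee_wpmul2l; first by rewrite lee_fin divr_ge0// ltW.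
  by apply: mean_deviation_le_sd => //; exact: Rintegral_norm2_sqr.
Qed.
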